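(* For every positive integer $r$, the circular ladder graph $CL_{2r+1}$ does not admit a $q$-coloured MINI-orientation for any $q\in\mathbb{N}$. Consequently, for $p\geq 2$, no $2p$-regular $(p+2)$-star colourable graph contains $CL_{2r+1}$ as a subgraph.
   Context: $CL_t$ is the Cartesian product $C_t\,\square\,K_2$ (vertices $u_i,v_i$, $i\in\mathbb{Z}_t$, edges $u_iu_{i+1}$, $v_iv_{i+1}$, $u_iv_i$). For an orientation $\vec{G}$ of $G$ and a $q$-colouring $f$ of $G$ (proper colouring with colours $\mathbb{Z}_q$), $(\vec{G},f)$ is a $q$-coloured MINI-orientation if for every vertex $v$: (i) no out-neighbour of $v$ has the same colour as an in-neighbour of $v$; (ii) the out-neighbours of $v$ have pairwise distinct colours; (iii) all in-neighbours of $v$ have the same colour. A $k$-star colouring is a proper colouring with $k$ colours such that the subgraph induced by any two colour classes has every component a star. *)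

(* Defs.v *)
From mathcomp Require Import all_boot.

Set Implicit Arguments.
Unset Strict Implicit.
Unset Printing Implicit Defensive.

Record sgraph := SGraph {
  vertex :> finType;
  edge : rel vertex;
  edge_sym : symmetric edge;
  edge_irrefl : irreflexive edge
}.

Notation "x -- y" := (edge x y) (at level 30, no associativity).

(* The test [i != j] only matters for [t = 1], where it removes a loop. *)
Definition cycle_edge t : rel 'I_t :=
  fun i j => (i != j) && ((j == ordS i) || (i == ordS j)).

Lemma cycle_edge_sym t : symmetric (@cycle_edge t).
Proof. by move=> i j; rewrite /cycle_edge eq_sym orbC. Qed.

Lemma cycle_edge_irrefl t : irreflexive (@cycle_edge t).
Proof. by move=> i; rewrite /cycle_edge eqxx. Qed.

Definition cycle_graph t : sgraph :=
  SGraph (@cycle_edge_sym t) (@cycle_edge_irrefl t).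

Definition complete_edge n : rel 'I_n := fun i j => i != j.

Lemma complete_edge_sym n : symmetric (@complete_edge n).
Proof. by move=> i j; rewrite /complete_edge eq_sym. Qed.

Lemma complete_edge_irrefl n : irreflexive (@complete_edge n).
Proof. by move=> i; rewrite /complete_edge eqxx. Qed.

Definition complete_graph n : sgraph :=
  SGraph (@complete_edge_sym n) (@complete_edge_irrefl n).

Section CartesianProduct.
Variables G H : sgraph.

Definition cart_edge : rel (G * H)%type := fun x y =>
  ((x.1 == y.1) && (x.2 -- y.2)) || ((x.2 == y.2) && (x.1 -- y.1)).

Lemma cart_edge_sym : symmetric cart_edge.
Proof.
by move=> x y; rewrite /cart_edge !(eq_sym y.1) !(eq_sym y.2) !(edge_sym y.1)
  !(edge_sym y.2).
Qed.

Lemma cart_edge_irrefl : irreflexive cart_edge.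
Proof. by move=> x; rewrite /cart_edge !edge_irrefl !andbF. Qed.

Definition cart_prod : sgraph := SGraph cart_edge_sym cart_edge_irrefl.

End CartesianProduct.

Definition circular_ladder t : sgraph :=
  cart_prod (cycle_graph t) (complete_graph 2).

Section Induced.
Variables (G : sgraph) (S : {set G}).

Definition induced_edge : rel {x : G | x \in S} := fun x y => val x -- val y.

Lemma induced_edge_sym : symmetric induced_edge.
Proof. by move=> x y; exact: edge_sym. Qed.

Lemma induced_edge_irrefl : irreflexive induced_edge.
Proof. by move=> x; exact: edge_irrefl. Qed.

Definition induced : sgraph := SGraph induced_edge_sym induced_edge_irrefl.

End Induced.

Definition component (G : sgraph) (x : G) : {set G} :=
  [set y | connect (@edge G) x y].

(* K_{1,n} for some n >= 0, with centre [c]; a single vertex is a star. *)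
Definition is_star (G : sgraph) : Prop :=
  exists c : G, forall x y : G, x -- y = (x != y) && ((x == c) || (y == c)).

(* [H] is isomorphic to a (not necessarily induced) subgraph of [G]. *)
Definition contains_subgraph (G H : sgraph) : Prop :=
  exists2 h : H -> G, injective h & forall x y : H, x -- y -> h x -- h y.

Definition regular (G : sgraph) (d : nat) : Prop :=
  forall x : G, #|[set y : G | x -- y]| = d.

(* Only equality of colours matters, so Z_q is just its underlying set
   ['I_q]; MathComp's ['Z_q] would have two elements for q = 0 and q = 1. *)
Definition proper_colouring (G : sgraph) (q : nat) (f : G -> 'I_q) : Prop :=
  forall x y : G, x -- y -> f x != f y.

Definition star_colouring (G : sgraph) (k : nat) (f : G -> 'I_k) : Prop :=
  proper_colouring f /\
  forall i j : 'I_k, i != j ->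
    forall x : induced [set v : G | (f v == i) || (f v == j)],
      is_star (induced (component x)).

Definition star_colourable (G : sgraph) (k : nat) : Prop :=
  exists f : G -> 'I_k, star_colouring f.

(* [d x y] means that the edge xy is directed from x to y. *)
Definition orientation (G : sgraph) (d : rel G) : Prop :=
  (forall x y : G, x -- y = d x y || d y x) /\
  (forall x y : G, d x y -> ~~ d y x).

Definition coloured_MINI_orientation (G : sgraph) (q : nat)
    (d : rel G) (f : G -> 'I_q) : Prop :=
  [/\ orientation d,
      proper_colouring f
    & forall v : G,
      [/\ forall x y : G, d v x -> d y v -> f x != f y,
          forall x y : G, d v x -> d v y -> x != y -> f x != f y
        & forall x y : G, d x v -> d y v -> f x = f y]].

Definition admits_MINI_orientation (G : sgraph) (q : nat) : Prop :=
  exists (d : rel G) (f : G -> 'I_q), coloured_MINI_orientation d f.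

(* Main.v *)
(** In a 4-cycle of a graph with a coloured MINI-orientation, opposite edges
    point the same way round the cycle: otherwise some vertex of the cycle
    has two equally coloured neighbours that are not both in-neighbours, or
    two in-neighbours of different colours. Hence the rungs of a circular
    ladder are directed alternately, which is impossible when there are an
    odd number of them.

    Given a star colouring, direct every edge that lies in a bicoloured star
    with at least two edges towards the centre of that star, and the remaining
    edges arbitrarily. Conditions (i) and (ii) then hold. At each vertex its own
    colour, the colours of its out-neighbours and those of its in-neighbours
    are disjoint, so that with [p + 2] colours and degree [2p] every
    out-degree is at most [p]. As out-degrees and in-degrees have the same sum,
    every out-degree is exactly [p], which leaves a single colour for the
    in-neighbours: this is (iii). MINI-orientations restrict to subgraphs, so
    the second claim follows from the first. *)

Require Import Defs.
From mathcomp Require Import all_boot zify.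

Set Implicit Arguments.
Unset Strict Implicit.
Unset Printing Implicit Defensive.

(** By injectivity [A] and its preimage, here its complement, are equinumerous. *)
Lemma card_alternating (T : finType) (s : T -> T) (A : {set T}) :
  injective s -> s @^-1: A = ~: A -> ~~ odd #|T|.
Proof.
move=> s_inj sA; rewrite -(cardsC A) -sA card_preimset //.
by rewrite addnn odd_double.
Qed.

Lemma sum_outdegree (T : finType) (d : rel T) :
  \sum_x #|[set y | d x y]| = \sum_x #|[set y | d y x]|.
Proof.
under eq_bigr do rewrite -sum1dep_card.
under [RHS]eq_bigr do rewrite -sum1dep_card.
by rewrite (exchange_big_dep predT).
Qed.

Section MINI.
Variables (G : sgraph) (q : nat) (d : rel G) (f : G -> 'I_q).
Hypothesis mini : coloured_MINI_orientation d f.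

Lemma MINI_square_imp (a b c e : G) :
  a != c -> b != e -> b -- c -> c -- e -> e -- a -> d a b -> d c e.
Proof.
case: mini => -[dE _] _ /all_and3[h1 h2 h3] nac nbe bc ce ea dab.
rewrite dE in ce; case/orP: ce => // dec.
rewrite dE in bc; rewrite dE in ea.
(* Assume that [e] points to [c]. If [a] and [c] share a colour, [e] violates (i) or (ii); otherwise
   [b] points to [c], so [b] and [e] share a colour by (iii) and [a] violates (i) or (ii). *)
have [fac|fac] := eqVneq (f a) (f c).
  case/orP: ea => [dea|dae].
    by have := h2 _ _ _ dea dec nac; rewrite fac eqxx.
  by have := h1 _ _ _ dec dae; rewrite fac eqxx.
have fbe : f b = f e.
  case/orP: bc => [dbc|dcb]; first exact: h3 dbc dec.
  by rewrite (h3 _ _ _ dab dcb) eqxx in fac.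
case/orP: ea => [dea|dae].
  by have := h1 _ _ _ dab dea; rewrite fbe eqxx.
by have := h2 _ _ _ dab dae nbe; rewrite fbe eqxx.
Qed.

Lemma MINI_square (a b c e : G) :
  a != c -> b != e -> a -- b -> b -- c -> c -- e -> e -- a -> d a b = d c e.
Proof.
move=> nac nbe ab bc ce ea; apply/idP/idP; first exact: MINI_square_imp.
by apply: MINI_square_imp => //; rewrite eq_sym.
Qed.

End MINI.

Lemma MINI_subgraph (G H : sgraph) q :
  contains_subgraph G H -> admits_MINI_orientation G q ->
  admits_MINI_orientation H q.
Proof.
case=> h h_inj hE [d [f [[dE dA] fP mini]]].
exists (fun x y => x -- y && d (h x) (h y)), (f \o h).
split; first split.
- move=> x y; rewrite (edge_sym y x) -andb_orr -dE.
  by case xy: (x -- y) => //=; rewrite hE.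
- by move=> x y /andP[_ /dA dyx]; rewrite negb_and dyx orbT.
- by move=> x y /hE /fP.
move=> v; have [h1 h2 h3] := mini (h v); split=> x y /andP[_ dx] /andP[_ dy].
- exact: h1.
- by move=> nxy; apply: h2; rewrite ?(inj_eq h_inj).
- exact: h3.
Qed.

Lemma odd_ladder_no_MINI t q :
  odd t -> 1 < t -> ~ admits_MINI_orientation (circular_ladder t) q.
Proof.
move=> t_odd t_gt1 [d [f mini]].
pose u i : circular_ladder t := (i, ord0).
pose v i : circular_ladder t := (i, ord_max).
have neS (i : 'I_t) : i != ordS i.
  apply/eqP => /(congr1 val) /= iS; have := ltn_ord i.
  rewrite leq_eqVlt => /orP[/eqP it|lt].
    by move: iS; rewrite it modnn; lia.
  by move: iS; rewrite modn_small //; lia.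
have uv i : u i -- v i by rewrite /= /cart_edge /= eqxx.
have uS i : u i -- u (ordS i).
  by rewrite /= /cart_edge /= /cycle_edge neS !eqxx orbT.
have vS i : v i -- v (ordS i).
  by rewrite /= /cart_edge /= /cycle_edge neS !eqxx orbT.
have rungS i : d (u (ordS i)) (v (ordS i)) = ~~ d (u i) (v i).
  have -> : d (u i) (v i) = d (v (ordS i)) (u (ordS i)).
    apply: (MINI_square mini) => //.
    - by rewrite xpair_eqE negb_and neS.
    - by rewrite xpair_eqE negb_and neS.
    - by rewrite edge_sym.
    - by rewrite edge_sym.
  case: mini => -[dE dA] _ _.
  have := uv (ordS i); rewrite dE => /orP[] /[dup] /dA /negbTE -> -> //.
have := @card_alternating 'I_t (@ordS t) [set i | d (u i) (v i)] (@ordS_inj t).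
rewrite card_ord t_odd => H; suff: false by [].
by apply: H; apply/setP => i; rewrite !inE rungS.
Qed.

(** The centre of a star lies on every edge, but no vertex lies on all three of [zy], [yx] and
    [xw]. *)
Lemma star_colouring_no_P4 (G : sgraph) k (f : G -> 'I_k) (z y x w : G) :
  star_colouring f -> z -- y -> y -- x -> x -- w -> f z = f x -> f y = f w ->
  z != x -> y != w -> False.
Proof.
move=> [fP fS] zy yx xw fzx fyw nzx nyw.
have nfxy : f x != f y by rewrite eq_sym fP.
pose S := [set v : G | (f v == f x) || (f v == f y)].
have zS : z \in S by rewrite inE fzx eqxx.
have yS : y \in S by rewrite inE eqxx orbT.
have xS : x \in S by rewrite inE eqxx.
have wS : w \in S by rewrite inE -fyw eqxx orbT.
pose z' : induced S := Sub z zS; pose y' : induced S := Sub y yS.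
pose x' : induced S := Sub x xS; pose w' : induced S := Sub w wS.
have zC : z' \in component z' by rewrite inE connect0.
have yC : y' \in component z' by rewrite inE connect1.
have xC : x' \in component z'.
  rewrite inE; apply: (@connect_trans _ _ y'); first exact: connect1.
  exact: connect1.
have wC : w' \in component z'.
  move: xC; rewrite !inE => /connect_trans; apply; exact: connect1.
case: (fS _ _ nfxy z') => c cP.
have := cP (Sub z' zC) (Sub y' yC).
have := cP (Sub y' yC) (Sub x' xC).
have := cP (Sub x' xC) (Sub w' wC).
rewrite /= /induced_edge /= /induced_edge /= zy yx xw.
move=> /esym/andP[_ /orP h1] /esym/andP[_ /orP h2] /esym/andP[_ /orP h3].
have nzw : z != w.
  by apply: contraNneq nfxy => zw; rewrite -fzx zw fyw.
have nxy : x != y by apply: contraNneq nfxy => ->.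
case: h2 => /eqP c2; [case: h1|case: h3] => /eqP c1.
all: move: c1; rewrite -c2 => /(congr1 (fun s => val (val s))) /= e.
- by rewrite e eqxx in nxy.
- by rewrite e eqxx in nyw.
- by rewrite e eqxx in nzx.
- by rewrite e eqxx in nxy.
Qed.

Section StarOrientation.
Variables (G : sgraph) (k : nat) (f : G -> 'I_k).

(** For an edge [xy] of a star-coloured graph: [y] is the centre of a bicoloured star with leaves
    [x] and [z]. *)
Definition into_centre (x y : G) : bool :=
  [exists z, [&& z != x, z -- y & f z == f x]].

(* The enumeration rank only breaks ties on bicoloured components that are
   single edges. *)
Definition star_orientation (x y : G) : bool :=
  x -- y &&
  (into_centre x y ||
   ~~ into_centre y x && (enum_rank x < enum_rank y)).

Hypothesis fS : star_colouring f.

(** Otherwise the two witnesses extend [xy] to a bicoloured path on four vertices. *)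
Lemma into_centre_asym x y : x -- y -> into_centre x y -> ~~ into_centre y x.
Proof.
move=> xy /existsP[z /and3P[nzx zy /eqP fzx]].
apply/existsP => -[w /and3P[nwy wx /eqP fwy]].
apply: (star_colouring_no_P4 fS zy _ _ fzx (esym fwy)) => //.
- by rewrite edge_sym.
- by rewrite edge_sym.
- by rewrite eq_sym.
Qed.

Lemma star_orientationP : orientation star_orientation.
Proof.
split=> x y; rewrite /star_orientation (edge_sym y x).
  have [xy|//] := boolP (x -- y); rewrite /=.
  have nxy : x != y by apply: contraTneq xy => ->; rewrite edge_irrefl.
  have nr : enum_rank x != enum_rank y by rewrite (inj_eq enum_rank_inj).
  case: (into_centre x y); case: (into_centre y x) => //=.
  by rewrite -neq_ltn; exact/esym.
move=> /andP[xy]; rewrite xy /= => /orP[cxy|/andP[ncyx lt]].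
  by rewrite cxy (negbTE (into_centre_asym xy cxy)).
by rewrite (negbTE ncyx) /= negb_and -leqNgt (ltnW lt) orbT.
Qed.

Lemma star_orientation_edge x y : star_orientation x y -> x -- y.
Proof. by case/andP. Qed.

(** Two neighbours of [v] of one colour make [v] a centre, so neither edge leaves [v]. As the edge
    [vy] may point either way, this yields both (i) and (ii). *)
Lemma star_orientation_out v x y :
  star_orientation v x -> v -- y -> x != y -> f x != f y.
Proof.
move=> /andP[vx h] vy nxy; apply/eqP => fxy.
have cxv : into_centre x v.
  by apply/existsP; exists y; rewrite eq_sym nxy edge_sym vy fxy eqxx.
rewrite edge_sym in vx.
by rewrite cxv (negbTE (into_centre_asym vx cxv)) in h.
Qed.

Lemma star_orientation_in_out v x y :
  star_orientation v x -> star_orientation y v -> f x != f y.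
Proof.
move=> vx yv; apply: (star_orientation_out vx).
  by rewrite edge_sym star_orientation_edge.
by apply: contraTneq yv => <-; case: star_orientationP => _; exact.
Qed.

Lemma outdegree_colours v :
  #|[set y | star_orientation v y]| +
    #|f @: [set y | star_orientation y v]| < k.
Proof.
set O := [set y | _]; set I := [set y | _].
have <- : #|f @: O| = #|O|.
  apply: card_in_imset => x y; rewrite !inE => vx /star_orientation_edge vy fxy.
  by apply/eqP/negPn/negP => /(star_orientation_out vx vy); rewrite fxy eqxx.
have dOI : [disjoint f @: O & f @: I].
  apply/pred0P => c /=; apply/negP => /andP[/imsetP[x] + ->] /imsetP[y].
  rewrite !inE => yv vx fxy.
  by have := star_orientation_in_out yv vx; rewrite fxy eqxx.
have /eqP <- : #|f @: O :|: f @: I| == #|f @: O| + #|f @: I|.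
  by rewrite (leq_card_setU _ _).2.
(* The colour of [v] makes the inequality strict. *)
have fv : f v \notin f @: O :|: f @: I.
  rewrite inE negb_or; apply/andP; split; apply/imsetP => -[y];
    rewrite inE => /star_orientation_edge /(proj1 fS) + e; by rewrite e eqxx.
rewrite -[X in _ < X]card_ord; have := cardsC (f @: O :|: f @: I).
move=> <-; rewrite -addn1 leq_add2l card_gt0.
by apply/set0Pn; exists (f v); rewrite inE.
Qed.

End StarOrientation.

Lemma star_colourable_MINI (G : sgraph) p :
  2 <= p -> regular G (2 * p) -> star_colourable G (p + 2) ->
  admits_MINI_orientation G (p + 2).
Proof.
move=> p_ge2 Gr [f fS]; have [fP _] := fS; pose d := star_orientation f.
have [dE dA] := star_orientationP fS.
pose O v := [set y | d v y]; pose I v := [set y | d y v].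
have degE v : #|O v| + #|I v| = 2 * p.
  rewrite -(Gr v) -cardsUI.
  have -> : O v :&: I v = set0.
    by apply/setP => y; rewrite !inE; apply/negP => /andP[/dA/negP].
  by rewrite cards0 addn0; apply: eq_card => y; rewrite !inE dE.
have colE v : #|O v| + #|f @: I v| < p + 2 := outdegree_colours fS v.
have O_le_I v : #|O v| <= #|I v|.
  (* With no in-neighbour, [v] would have [2 * p] out-neighbours of distinct colours, too many as
     [2 <= p]. *)
  have [I0|I_n0] := eqVneq (I v) set0.
    by have := degE v; have := colE v; rewrite I0 imset0 !cards0; lia.
  have : 0 < #|f @: I v| by rewrite card_gt0 imset_eq0.
  by have := degE v; have := colE v; lia.
have O_eq_I v : #|O v| = #|I v|.
  (* A termwise inequality between equal sums is an equality in every term. *)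
  have /leqif_sum[_] :
      forall v, true -> #|O v| <= #|I v| ?= iff (#|O v| == #|I v|).
    by move=> w _; apply/leqif_eq.
  rewrite sum_outdegree eqxx => /esym/forallP/(_ v)/eqP; exact.
exists d, f; split=> // v; split=> x y dx dy.
- exact: star_orientation_in_out dx dy.
- exact: star_orientation_out dx (star_orientation_edge dy).
have /card_le1_eqP : #|f @: I v| <= 1.
  by have := degE v; have := colE v; rewrite O_eq_I; lia.
by apply; apply: imset_f; rewrite inE.
Qed.

Theorem theorem17 :
  (forall r : nat, 0 < r ->
     forall q : nat, ~ admits_MINI_orientation (circular_ladder (2 * r + 1)) q)
  /\
  (forall r : nat, 0 < r ->
     forall p : nat, 2 <= p ->
     forall G : sgraph, regular G (2 * p) -> star_colourable G (p + 2) ->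
       ~ contains_subgraph G (circular_ladder (2 * r + 1))).
Proof.
have no_MINI r : 0 < r ->
    forall q, ~ admits_MINI_orientation (circular_ladder (2 * r + 1)) q.
  by move=> r_gt0 q; apply: odd_ladder_no_MINI; lia.
split=> // r r_gt0 p p_ge2 G Gr Gs sub.
exact: no_MINI r_gt0 _ (MINI_subgraph sub (star_colourable_MINI p_ge2 Gr Gs)).
Qed.
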